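(* Let $n\ge2$, let $\phi:S^{n-1}\to\mathbb R$ be continuous, let $r_\pm>0$ and $\Theta_\pm\in S^{n-1}$ with $\Theta_-\cdot\Theta_+\neq\pm1$, put $\phi_\pm=\phi(\Theta_\pm)$ and suppose $\phi_->\phi_+$. For $\Theta\in S^{n-1}\cap\mathrm{span}\{\Theta_-,\Theta_+\}$ set $$\mathcal F(\Theta)=\varrho^{-1}\Big((\phi(\Theta)-\phi_+)\,r_+\Theta_++(\phi_--\phi(\Theta))\,r_-\Theta_-\Big),$$ where $\varrho=\varrho(\Theta)=\big|(\phi(\Theta)-\phi_+)\,r_+\Theta_++(\phi_--\phi(\Theta))\,r_-\Theta_-\big|$. Then there exists a fixed point $\Theta_\sigma\in S^{n-1}\cap\mathrm{span}\{\Theta_-,\Theta_+\}$, $\Theta_\sigma=\mathcal F(\Theta_\sigma)$, satisfying the inequalities $$\phi_->\phi(\Theta_\sigma)>\phi_+ .$$ *)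

(* Defs.v *)
From HB Require Import structures.
From mathcomp Require Import all_boot all_order all_algebra.
From mathcomp Require Import all_classical all_reals all_analysis.

Set Implicit Arguments.
Unset Strict Implicit.
Unset Printing Implicit Defensive.

Import Order.TTheory GRing.Theory Num.Theory.
Import numFieldNormedType.Exports.

Local Open Scope classical_set_scope.
Local Open Scope ring_scope.

Definition dotmul (R : realType) (n : nat) (u v : 'rV[R]_n) : R :=
  \sum_(i < n) u ord0 i * v ord0 i.

(* The library norm `|u| on row vectors is the sup norm, hence this one. *)
Definition enorm (R : realType) (n : nat) (u : 'rV[R]_n) : R :=
  Num.sqrt (dotmul u u).

Definition sphere (R : realType) (n : nat) : set 'rV[R]_n :=
  [set u | enorm u = 1].

Definition span2 (R : realType) (n : nat) (u v : 'rV[R]_n) : set 'rV[R]_n :=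
  [set w | w \in <<[:: u; v]>>%VS].

Section FixedPointMap.
Variables (R : realType) (n : nat) (phi : 'rV[R]_n -> R).
Variables (rm rp : R) (Tm Tp : 'rV[R]_n).

Definition Fnum (T : 'rV[R]_n) : 'rV[R]_n :=
  ((phi T - phi Tp) * rp) *: Tp + ((phi Tm - phi T) * rm) *: Tm.

Definition varrho (T : 'rV[R]_n) : R := enorm (Fnum T).

(* If [varrho T] were 0, this would be the zero vector, which is not on the
   sphere; so a fixed point on the sphere never comes from 0^-1 = 0. *)
Definition Fmap (T : 'rV[R]_n) : 'rV[R]_n := (varrho T)^-1 *: Fnum T.

End FixedPointMap.

(* Main.v *)
Require Import Defs.
From HB Require Import structures.
From mathcomp Require Import all_boot all_order all_algebra.
From mathcomp Require Import all_classical all_reals all_analysis.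
From mathcomp Require Import ring lra.

(** The expression F(T) depends on T only through the value c = phi(T): it is
    the normalization of
      w(c) = (c - phi_+) r_+ T_+ + (phi_- - c) r_- T_- .
    Hence T is a fixed point as soon as T = w(c) / |w(c)| for some c with
    phi(T) = c, and the search reduces to a scalar one: find a fixed point of
    g(c) = phi(w(c) / |w(c)|).

    Since T_+ and T_- are unit vectors with inner product different from 1 and
    -1, they are linearly independent, so w never vanishes
    ([enorm_comb_gt0]); the normalized curve is therefore continuous, lies on
    the sphere, and g is continuous.  At c = phi_+ the curve points in the
    direction T_-, so g(phi_+) = phi_-; at c = phi_- it points in the direction
    T_+, so g(phi_-) = phi_+.  The function g(c) - c thus changes sign on
    [phi_+, phi_-] and vanishes somewhere by the intermediate value theorem,
    and it does not vanish at the endpoints because phi_+ < phi_-; this gives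
    the strict inequalities. *)

Set Implicit Arguments.
Unset Strict Implicit.
Unset Printing Implicit Defensive.

Import Order.TTheory GRing.Theory Num.Theory.
Import numFieldNormedType.Exports.

Local Open Scope classical_set_scope.
Local Open Scope ring_scope.

Section Euclidean.
Variables (R : realType) (n : nat).
Implicit Types (u v : 'rV[R]_n) (a b : R).

Lemma dotmul_ge0 u : 0 <= dotmul u u.
Proof. by apply: sumr_ge0 => i _; rewrite -expr2 sqr_ge0. Qed.

Lemma dotmul_comb u v a b :
  dotmul (a *: u + b *: v) (a *: u + b *: v) =
  a ^+ 2 * dotmul u u + 2 * a * b * dotmul u v + b ^+ 2 * dotmul v v.
Proof.
rewrite /dotmul !mulr_sumr -!big_split /=; apply: eq_bigr => i _.
by rewrite !mxE; ring.
Qed.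

Lemma enormZ a u : enorm (a *: u) = `|a| * enorm u.
Proof.
rewrite /enorm -sqrtr_sqr -sqrtrM ?sqr_ge0//; congr Num.sqrt.
by rewrite /dotmul mulr_sumr; apply: eq_bigr => i _; rewrite !mxE; ring.
Qed.

Lemma dotmul_sphere u : sphere u -> dotmul u u = 1.
Proof.
by move=> u1; rewrite -(sqr_sqrtr (dotmul_ge0 u)) -/(enorm u) u1 expr1n.
Qed.

(** The squared norm is
    (a + b d)^2 + b^2 (1 - d^2) with d the inner product of u and v, and
    |d| < 1: that |d| <= 1 comes from |u + v|^2 >= 0 and |u - v|^2 >= 0. *)
Lemma enorm_comb_gt0 u v a b : sphere u -> sphere v ->
  dotmul u v <> 1 -> dotmul u v <> -1 -> (a != 0) || (b != 0) ->
  0 < enorm (a *: u + b *: v).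
Proof.
move=> u1 v1 /eqP d1 /eqP dN1 ab0; rewrite /enorm sqrtr_gt0.
have := dotmul_ge0 (1 *: u + 1 *: v); have := dotmul_ge0 (1 *: u + (-1) *: v).
rewrite !dotmul_comb !dotmul_sphere//; set d := dotmul u v => Hm Hp.
have dlt1 : d < 1 by rewrite lt_neqAle d1 /=; lra.
have dgtN1 : -1 < d by rewrite lt_neqAle eq_sym dN1 /=; lra.
have d2 : 0 < (1 - d) * (1 + d) by apply: mulr_gt0; lra.
have -> : a ^+ 2 * 1 + 2 * a * b * d + b ^+ 2 * 1
        = (a + b * d) ^+ 2 + b ^+ 2 * ((1 - d) * (1 + d)) by ring.
have [b0|b0] := eqVneq b 0.
  move: ab0; rewrite b0 eqxx orbF => a0.
  by rewrite mul0r addr0 expr0n mul0r addr0 exprn_even_gt0.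
apply: ltr_wpDl; first exact: sqr_ge0.
by apply: mulr_gt0 => //; rewrite exprn_even_gt0.
Qed.

Definition normalize u := (enorm u)^-1 *: u.

Lemma normalize_sphere u : 0 < enorm u -> sphere (normalize u).
Proof.
move=> u0; rewrite /sphere /= enormZ ger0_norm ?invr_ge0 ?ltW//.
by rewrite mulVf// gt_eqF.
Qed.

Lemma normalizeZ_sphere a u : 0 < a -> sphere u -> normalize (a *: u) = u.
Proof.
move=> a0 u1; rewrite /normalize enormZ u1 mulr1 gtr0_norm// scalerA.
by rewrite mulVf ?gt_eqF// scale1r.
Qed.

Lemma enorm_continuous : continuous (@enorm R n).
Proof.
have dot_cont : continuous (fun v : 'rV[R]_n => dotmul v v).
  apply: continuous_big => [|i _ v]; first exact: add_continuous.
  by apply: (@continuousM _ _ _ _ v); exact: (@coord_continuous R 1 n ord0 i).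
move=> u; apply: (continuous_comp (dot_cont u)); exact: sqrt_continuous.
Qed.

Lemma normalize_continuous u : 0 < enorm u -> {for u, continuous normalize}.
Proof.
move=> u0; apply: continuousZ; last exact: cvg_id.
by apply: continuousV; [rewrite gt_eqF|exact: enorm_continuous].
Qed.

End Euclidean.

(** A map with values in A converges to f x along the trace on A of the
    neighbourhoods of f x, which is the filter that continuity within A
    speaks of. *)
Lemma continuous_comp_within (T U V : topologicalType) (A : set U)
    (f : T -> U) (g : U -> V) :
  continuous f -> (forall x, A (f x)) -> {within A, continuous g} ->
  continuous (g \o f).
Proof.
move=> cf fA /subspace_continuousP cg x B /(cg _ (fA x)) /cf nB.
rewrite !nbhs_simpl /= in nB *.
apply: filterS nB => y /=; apply; exact: fA.
Qed.

Theorem lemma5p54 (R : realType) (n : nat) (hn : (2 <= n)%N)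
  (phi : 'rV[R]_n -> R)
  (hphi : {within @sphere R n, continuous phi})
  (rm rp : R) (hrm : 0 < rm) (hrp : 0 < rp)
  (Tm Tp : 'rV[R]_n)
  (hTm : @sphere R n Tm) (hTp : @sphere R n Tp)
  (hdot1 : dotmul Tm Tp <> 1) (hdotN1 : dotmul Tm Tp <> -1)
  (hlt : phi Tp < phi Tm) :
  exists Ts : 'rV[R]_n,
    [/\ (@sphere R n `&` span2 Tm Tp) Ts,
        Ts = Fmap phi rm rp Tm Tp Ts,
        phi Ts < phi Tm
      & phi Tp < phi Ts].
Proof.
(* The curve is indexed by the value c that phi should take, so that F(T) is
   the normalization of w (phi T) with no further rescaling. *)
pose w c := ((phi Tm - c) * rm) *: Tm + ((c - phi Tp) * rp) *: Tp.
have FmapE T : Fmap phi rm rp Tm Tp T = normalize (w (phi T)).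
  by rewrite /Fmap /varrho /Fnum addrC.
have w_gt0 c : 0 < enorm (w c).
  apply: enorm_comb_gt0 => //; rewrite !mulf_eq0 !subr_eq0.
  rewrite (gt_eqF hrm) (gt_eqF hrp) !orbF -negb_and.
  by apply/andP => -[/eqP <- /eqP cE]; move: hlt; rewrite cE ltxx.
have w_cont : continuous w.
  have cm : continuous (fun c : R => (phi Tm - c) * rm).
    by move=> c; apply: cvgM; [apply: cvgB|];
      by [exact: cvg_cst|exact: cvg_id].
  have cp : continuous (fun c : R => (c - phi Tp) * rp).
    by move=> c; apply: cvgM; [apply: cvgB|];
      by [exact: cvg_cst|exact: cvg_id].
  by move=> c; apply: cvgD; apply: cvgZr_tmp; [exact: cm|exact: cp].
pose g c := phi (normalize (w c)).
have g_cont : continuous g.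
  apply: (continuous_comp_within (f := @normalize R n \o w) _ _ hphi).
    move=> c; apply: continuous_comp; first exact: w_cont.
    exact: normalize_continuous.
  by move=> c; exact: normalize_sphere.
have gp : g (phi Tp) = phi Tm.
  rewrite /g /w subrr mul0r scale0r addr0 normalizeZ_sphere//.
  by rewrite mulr_gt0// subr_gt0.
have gm : g (phi Tm) = phi Tp.
  rewrite /g /w subrr mul0r scale0r add0r normalizeZ_sphere//.
  by rewrite mulr_gt0// subr_gt0.
have [||c] := @IVT R (fun c => g c - c) _ _ 0 (ltW hlt).
- apply: continuous_subspaceT => c.
  by apply: cvgB; [exact: g_cont|exact: cvg_id].
- by rewrite gp gm ge_min le_max; apply/andP; split; apply/orP;
    [right|left]; lra.
rewrite in_itv /= => /andP[pc cm] /eqP; rewrite subr_eq0 => /eqP gc.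
have c_lt : c < phi Tm.
  rewrite lt_neqAle cm andbT; apply/eqP => cE.
  by move: hlt; rewrite -gm -cE gc ltxx.
have c_gt : phi Tp < c.
  rewrite lt_neqAle pc andbT; apply/eqP => cE.
  by move: hlt; rewrite -gp cE gc ltxx.
exists (normalize (w c)); split.
- split; first exact: normalize_sphere.
  apply/memvZ/memvD; apply/memvZ/memv_span.
    by rewrite !inE eqxx.
  by rewrite !inE eqxx orbT.
- by rewrite FmapE -/(g c) gc.
- by rewrite -/(g c) gc.
- by rewrite -/(g c) gc.
Qed.
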